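(* Let $q$ be a prime power. The minimum distance of the polar orthogonal Grassmann code $C(\mathbb{O}_{3,6})$ over $\mathbb{F}_q$ is $$d(C(\mathbb{O}_{3,6}))=\begin{cases} q^3, & q \text{ even},\\ q^3-q^2, & q \text{ odd}.\end{cases}$$
   Context: Let $\mathbb{F}_q$ be the field with $q$ elements and $V=\mathbb{F}_q^6$, with the bilinear form $B(x,y)=\sum_{i=1}^{6}x_iy_{7-i}$ and the quadratic form $Q(x)=x_1x_6+x_2x_5+x_3x_4$. The polar orthogonal Grassmannian $\mathbb{O}_{3,6}$ is the set of all $3$-dimensional subspaces $W\subseteq V$ such that $B(v,w)=0$ and $Q(v)=0$ for all $v,w\in W$. For a $3$-element subset $I\subseteq\{1,\dots,6\}$ and a $3\times 6$ matrix $M$, $\det_I(M)$ is the determinant of the $3\times3$ submatrix of $M$ formed by the columns indexed by $I$ (in increasing order). Let $\Delta(3,6)$ be the set of all formal linear combinations $f=\sum_I c_I\det_I(\mathbf{X})$, with $c_I\in\mathbb{F}_q$ and $\mathbf{X}$ a generic $3\times 6$ matrix. Choose, for each $W\in\mathbb{O}_{3,6}$, exactly one $3\times 6$ matrix $M_W$ over $\mathbb{F}_q$ with row space $W$, and let $L=\{M_1,\dots,M_n\}$ be the resulting list of matrices. For $f\in\Delta(3,6)$ put $ev_L(f)=(f(M_1),\dots,f(M_n))\in\mathbb{F}_q^n$. The polar orthogonal Grassmann code is $C(\mathbb{O}_{3,6})=\{ev_L(f) : f\in\Delta(3,6)\}$. Its minimum distance is the minimum Hamming weight of a nonzero codeword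 (this does not depend on the choice of representatives). *)

(* Defs.v *)
From HB Require Import structures.
From mathcomp Require Import all_boot all_order all_algebra.

Set Implicit Arguments.
Unset Strict Implicit.
Unset Printing Implicit Defensive.

Import GRing.Theory.
Local Open Scope ring_scope.

(* Indices are 0-based: the coordinate x_i (1 <= i <= 6) is [x 0 (inord i.-1)],
   and i |-> 7 - i becomes [rev_ord]. *)

Definition B36 (F : finFieldType) (x y : 'rV[F]_6) : F :=
  \sum_(i < 6) x 0 i * y 0 (rev_ord i).

Definition Q36 (F : finFieldType) (x : 'rV[F]_6) : F :=
  x 0 (inord 0) * x 0 (inord 5)
  + x 0 (inord 1) * x 0 (inord 4)
  + x 0 (inord 2) * x 0 (inord 3).

Definition O36 (F : finFieldType) (W : {vspace 'rV[F]_6}) : Prop :=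
  \dim W = 3%N
  /\ forall v w : 'rV[F]_6, v \in W -> w \in W -> B36 v w = 0 /\ Q36 v = 0.

Definition rowspace (F : finFieldType) (m n : nat) (M : 'M[F]_(m, n)) :
    {vspace 'rV[F]_n} :=
  <<[seq row i M | i <- enum 'I_m]>>%VS.

Definition subset36 := {I : {set 'I_6} | #|I| == 3}.

(* [enum] lists the elements of a set of ordinals in increasing order; its
   default value [ord0] is never reached, since [#|I| = 3]. *)
Definition detI (F : finFieldType) (I : subset36) (M : 'M[F]_(3, 6)) : F :=
  \det (colsub (fun j : 'I_3 => nth ord0 (enum (val I)) j) M).

(* A formal linear combination of the 3 x 3 minors is its family of
   coefficients (c_I)_I. *)
Definition Delta36 (F : finFieldType) := {ffun subset36 -> F}.

Definition evalDelta (F : finFieldType) (f : Delta36 F) (M : 'M[F]_(3, 6)) : F :=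
  \sum_(I : subset36) f I * detI I M.

(* L contains exactly one matrix M_W with row space W for each W in O36, and
   nothing else. *)
Definition representatives (F : finFieldType) (n : nat)
    (L : n.-tuple 'M[F]_(3, 6)) : Prop :=
  (forall i : 'I_n, O36 (rowspace (tnth L i)))
  /\ (forall W : {vspace 'rV[F]_6}, O36 W ->
        exists! i : 'I_n, rowspace (tnth L i) = W).

Definition evL (F : finFieldType) (n : nat) (L : n.-tuple 'M[F]_(3, 6))
    (f : Delta36 F) : 'rV[F]_n :=
  \row_(i < n) evalDelta f (tnth L i).

Definition code36 (F : finFieldType) (n : nat) (L : n.-tuple 'M[F]_(3, 6)) :
    {set 'rV[F]_n} :=
  [set evL L f | f : Delta36 F].

Definition hamming_weight (F : finFieldType) (n : nat) (c : 'rV[F]_n) : nat :=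
  #|[set i : 'I_n | c 0 i != 0]|.

Definition is_min_distance (F : finFieldType) (n : nat) (C : {set 'rV[F]_n})
    (d : nat) : Prop :=
  (exists c : 'rV[F]_n, [/\ c \in C, c != 0 & hamming_weight c = d])
  /\ (forall c : 'rV[F]_n, c \in C -> c != 0 -> (d <= hamming_weight c)%N).

(* Main.v *)
(* The quadric Q is the Klein quadric: identify V with the skew 4x4 matrices, Q
   being the Pfaffian ([hat]).  Its maximal singular subspaces are the spaces
   s /\ F^4 ([wedge]), for s in PG(3,q), and the images of these under the isometry
   reversing the coordinates ([rev]), which swaps the two families.  On
   s /\ F^4 every 3x3 minor is, up to a common nonzero factor, 0 or a monomial
   +- s_i s_j, so a codeword is a pair (phi, psi) of quadratic forms in four
   variables, one for each family, and its weight is the number of projective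
   points off phi = 0 plus the number of those off psi = 0.  A nonzero quadratic
   form has at least q^3 - q^2 such points, and at least q^3 when its polar form
   vanishes.  For q odd the pair (s_0 s_1, 0) attains q^3 - q^2.  For q even the
   polar form of psi is dual to that of phi, so psi = 0 forces the polar form of
   phi to vanish; otherwise the weight is at least 2 (q^3 - q^2) >= q^3. *)
Require Import Defs.
From HB Require Import structures.
From mathcomp Require Import all_boot all_order all_algebra.
From mathcomp Require Import finfield ring zify.
Set Implicit Arguments.
Unset Strict Implicit.
Unset Printing Implicit Defensive.
Import GRing.Theory.
Local Open Scope ring_scope.

(** * Coordinates of short vectors and small determinants *)

Lemma forall_ord3 (P : 'I_3 -> Prop) :
  P (inord 0) -> P (inord 1) -> P (inord 2) -> forall i, P i.
Proof. by move=> ? ? ? i; rewrite -[i]inord_val; case: i => -[|[|[|]]]. Qed.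

Lemma forall_ord4 (P : 'I_4 -> Prop) :
  P (inord 0) -> P (inord 1) -> P (inord 2) -> P (inord 3) -> forall i, P i.
Proof. by move=> ? ? ? ? i; rewrite -[i]inord_val; case: i => -[|[|[|[|]]]]. Qed.

Lemma forall_ord6 (P : 'I_6 -> Prop) :
  P (inord 0) -> P (inord 1) -> P (inord 2) -> P (inord 3) -> P (inord 4) ->
  P (inord 5) -> forall i, P i.
Proof. by move=> ? ? ? ? ? ? i; rewrite -[i]inord_val; case: i => -[|[|[|[|[|[|]]]]]]. Qed.

Lemma sum_ord4 (R : nmodType) (f : 'I_4 -> R) :
  \sum_i f i = f (inord 0) + f (inord 1) + f (inord 2) + f (inord 3).
Proof.
rewrite !big_ord_recr big_ord0 /= add0r.
by do !congr (_ + _); congr f; apply: val_inj; rewrite /= inordK.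
Qed.

Lemma sum_ord6 (R : nmodType) (f : 'I_6 -> R) :
  \sum_i f i = f (inord 0) + f (inord 1) + f (inord 2) + f (inord 3)
               + f (inord 4) + f (inord 5).
Proof.
rewrite !big_ord_recr big_ord0 /= add0r.
by do !congr (_ + _); congr f; apply: val_inj; rewrite /= inordK.
Qed.

Lemma rev_inord6 k : (k < 6)%N -> rev_ord (inord k : 'I_6) = inord (5 - k).
Proof. by move=> lk; apply: val_inj; rewrite /= !inordK // ltnS leq_subr. Qed.

(** Entries are indexed by naturals, so that the [bump]ed indices of successive cofactors compute to
    literals. *)
Lemma det_matrix2 (R : comPzRingType) (a : nat -> nat -> R) :
  \det (\matrix_(i < 2, j < 2) a i j) = a 0 0 * a 1 1 - a 0 1 * a 1 0.
Proof.
rewrite (expand_det_row _ ord0) !big_ord_recl big_ord0 /cofactor.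
by rewrite !det_mx11 !mxE /= /bump /=; ring.
Qed.

Lemma det_matrix3 (R : comPzRingType) (a : nat -> nat -> R) :
  \det (\matrix_(i < 3, j < 3) a i j) =
    a 0 0 * (a 1 1 * a 2 2 - a 1 2 * a 2 1)
  - a 0 1 * (a 1 0 * a 2 2 - a 1 2 * a 2 0)
  + a 0 2 * (a 1 0 * a 2 1 - a 1 1 * a 2 0).
Proof.
have minorE (k : 'I_3) :
    \det (row' ord0 (col' k (\matrix_(i < 3, j < 3) a i j))) =
    a 1 (bump k 0) * a 2 (bump k 1) - a 1 (bump k 1) * a 2 (bump k 0).
  rewrite -(det_matrix2 (fun i j => a i.+1 (bump k j))); congr (\det _).
  by apply/matrixP => i j; rewrite !mxE.
rewrite (expand_det_row _ ord0) !big_ord_recl big_ord0 /cofactor.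
rewrite !minorE !mxE /= /bump /=; ring.
Qed.

Lemma det_matrix4 (R : comPzRingType) (a : nat -> nat -> R) :
  \det (\matrix_(i < 4, j < 4) a i j) =
    \sum_(k < 4) (-1) ^+ k * a 0 k *
      \det (\matrix_(i < 3, j < 3) a i.+1 (bump k j)).
Proof.
rewrite (expand_det_row _ ord0); apply: eq_bigr => k _.
rewrite mxE /cofactor add0n mulrCA mulrA; congr (_ * \det _).
by apply/matrixP => i j; rewrite !mxE.
Qed.

(* [ring] compares atoms up to conversion, and unfolding [inord] is expensive. *)
Ltac coord_ring := rewrite ?/subn /=;
  repeat match goal with |- context [@fun_of_matrix ?R ?m ?n ?A ?i ?j] =>
    generalize (@fun_of_matrix R m n A i j); let c := fresh "c" in intro c
  end; ring.

Local Notation "x ^[ k ]" := (x 0 (inord k%N)) (at level 2, format "x ^[ k ]").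

(** * The Klein correspondence *)

Section Spinors.
Variable F : finFieldType.
Implicit Types (x y z w : 'rV[F]_6) (s v t : 'rV[F]_4).

(** The sign of x_4 makes the Pfaffian equal to x_0 x_5 + x_1 x_4 + x_2 x_3, that is [Q36]. *)
Definition hat x : 'M[F]_4 :=
  \matrix_(i, j) nth 0 (nth [::]
    [:: [:: 0; x^[0]; x^[1]; x^[2]];
        [:: - x^[0]; 0; x^[3]; - x^[4]];
        [:: - x^[1]; - x^[3]; 0; x^[5]];
        [:: - x^[2]; x^[4]; - x^[5]; 0]] i) j.

Definition rev x : 'rV[F]_6 := \row_i x 0 (rev_ord i).

(** Plücker coordinates of s and v, the fifth with reversed sign to match [hat]; see [hat_wedge]. *)
Definition wedge s v : 'rV[F]_6 :=
  \row_k nth 0 [:: s^[0] * v^[1] - s^[1] * v^[0]; s^[0] * v^[2] - s^[2] * v^[0];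
      s^[0] * v^[3] - s^[3] * v^[0]; s^[1] * v^[2] - s^[2] * v^[1];
      s^[3] * v^[1] - s^[1] * v^[3]; s^[2] * v^[3] - s^[3] * v^[2]] k.

Lemma hatE x i j : (i < 4)%N -> (j < 4)%N ->
  hat x (inord i) (inord j) = nth 0 (nth [::]
    [:: [:: 0; x^[0]; x^[1]; x^[2]];
        [:: - x^[0]; 0; x^[3]; - x^[4]];
        [:: - x^[1]; - x^[3]; 0; x^[5]];
        [:: - x^[2]; x^[4]; - x^[5]; 0]] i) j.
Proof. by move=> li lj; rewrite mxE !inordK. Qed.

Lemma revE x k : (k < 6)%N -> rev x 0 (inord k) = x 0 (inord (5 - k)).
Proof. by move=> lk; rewrite mxE rev_inord6. Qed.

Lemma wedgeE s v k : (k < 6)%N ->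
  wedge s v 0 (inord k) =
    nth 0 [:: s^[0] * v^[1] - s^[1] * v^[0]; s^[0] * v^[2] - s^[2] * v^[0];
      s^[0] * v^[3] - s^[3] * v^[0]; s^[1] * v^[2] - s^[2] * v^[1];
      s^[3] * v^[1] - s^[1] * v^[3]; s^[2] * v^[3] - s^[3] * v^[2]] k.
Proof. by move=> lk; rewrite mxE inordK. Qed.

Lemma revK : involutive rev.
Proof. by move=> x; apply/rowP=> i; rewrite !mxE rev_ordK. Qed.

Lemma B36E x y : B36 x y =
  x^[0] * y^[5] + x^[1] * y^[4] + x^[2] * y^[3] +
  x^[3] * y^[2] + x^[4] * y^[1] + x^[5] * y^[0].
Proof. by rewrite /B36 sum_ord6 !rev_inord6. Qed.

Lemma Q36_rev x : Q36 (rev x) = Q36 x.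
Proof. rewrite /Q36 !revE //; coord_ring. Qed.

Lemma B36_rev x y : B36 (rev x) (rev y) = B36 x y.
Proof. rewrite !B36E /= !revE //; coord_ring. Qed.

(** Up to sign, [hat (rev x)] is the Pfaffian adjoint of [hat x]; the two matrices are the
    off-diagonal blocks of the Clifford action of x on spinors. *)
Lemma mulmx_hat_rev x : hat x *m hat (rev x) = - (Q36 x)%:M.
Proof.
apply/matrixP; elim/forall_ord4; elim/forall_ord4;
  rewrite mxE sum_ord4 !hatE // !revE // !mxE -val_eqE /= !inordK //= /Q36;
  coord_ring.
Qed.

Lemma hatD x y : hat (x + y) = hat x + hat y.
Proof.
apply/matrixP; elim/forall_ord4; elim/forall_ord4; rewrite !mxE !inordK //; coord_ring.
Qed.

Lemma hat_eq0 x : hat x = 0 -> x = 0.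
Proof.
move=> x0; have h i j := congr1 (fun A : 'M_4 => A (inord i) (inord j)) x0.
apply/rowP; elim/forall_ord6; rewrite mxE.
- by move: (h 0 1); rewrite !mxE !inordK.
- by move: (h 0 2); rewrite !mxE !inordK.
- by move: (h 0 3); rewrite !mxE !inordK.
- by move: (h 1 2); rewrite !mxE !inordK.
- by move: (h 3 1); rewrite !mxE !inordK.
- by move: (h 2 3); rewrite !mxE !inordK.
Qed.

Lemma revD x y : rev (x + y) = rev x + rev y.
Proof. by apply/rowP=> i; rewrite !mxE. Qed.

Lemma Q36D x y : Q36 (x + y) = Q36 x + Q36 y + B36 x y.
Proof. rewrite B36E /Q36 !mxE; ring. Qed.

Lemma mulmx_hat_revD x y :
  hat x *m hat (rev y) + hat y *m hat (rev x) = - (B36 x y)%:M.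
Proof.
have := mulmx_hat_rev (x + y).
rewrite revD !hatD mulmxDl !mulmxDr !mulmx_hat_rev Q36D.
move: (Q36 x) (Q36 y) (B36 x y) => a b c; rewrite !raddfD /= => e.
apply: (addrI (- a%:M - b%:M)); rewrite -[RHS]e.
by rewrite -!addrA; congr (_ + _); rewrite addrC addrA.
Qed.

Lemma hat_rev_anticomm x y : B36 x y = 0 ->
  hat x *m hat (rev y) = - (hat y *m hat (rev x)).
Proof.
by move=> b; apply/eqP; rewrite -addr_eq0 mulmx_hat_revD b raddf0 oppr0.
Qed.

Lemma rev_hat_anticomm x y : B36 x y = 0 ->
  hat (rev x) *m hat y = - (hat (rev y) *m hat x).
Proof.
by rewrite -B36_rev => /hat_rev_anticomm; rewrite !revK.
Qed.

Lemma B36C x y : B36 x y = B36 y x.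
Proof. rewrite !B36E /=; ring. Qed.

(* Multiply [hat x *m hat (rev y)] by the Clifford relation between z and w, and
   anticommute w past y and x in the second term. *)
Lemma spinor_product_step x y z w :
  B36 w x = 0 -> B36 w y = 0 -> B36 w z = 1 ->
  hat x *m hat (rev y) *m hat z = 0 ->
  hat (rev x) *m hat y *m hat (rev z) = 0 ->
  hat x *m hat (rev y) = 0.
Proof.
move=> wx wy wz xyz xyz'; rewrite B36C in wx; rewrite B36C in wy.
have /(congr1 (mulmx (hat x *m hat (rev y)))) := mulmx_hat_revD w z.
rewrite wz mulmxDr !mulmxA xyz mul0mx addr0 mulmxN mulmx1 => /eqP.
rewrite -(mulmxA (hat x)) (rev_hat_anticomm wy) mulmxN mulNmx !mulmxA.
rewrite (hat_rev_anticomm wx) !mulNmx opprK -!mulmxA (mulmxA (hat (rev x))).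
by rewrite xyz' mulmx0 eq_sym oppr_eq0 => /eqP.
Qed.

(** These are the two blocks of the Clifford product xyz. If both vanish, w2 strips off z and then
    w1 strips off y, leaving [hat x = 0]. *)
Lemma spinor_product_neq0 x y z w1 w2 : x != 0 ->
  B36 w1 x = 0 -> B36 w1 y = 1 ->
  B36 w2 x = 0 -> B36 w2 y = 0 -> B36 w2 z = 1 ->
  (hat x *m hat (rev y) *m hat z != 0) ||
  (hat (rev x) *m hat y *m hat (rev z) != 0).
Proof.
move=> x0 b1x b1y b2x b2y b2z; rewrite -negb_and; apply: contraNN x0.
case/andP=> /eqP xyz /eqP xyz'; apply/eqP/hat_eq0.
have xy := spinor_product_step b2x b2y b2z xyz xyz'.
(* The other block, by the same step applied to the reversed vectors. *)
have xy' : hat (rev x) *m hat y = 0.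
  by rewrite -[y]revK; apply: (@spinor_product_step _ _ (rev z) (rev w2));
    rewrite ?B36_rev ?revK.
rewrite B36C in b1x.
have /(congr1 (mulmx (hat x))) := mulmx_hat_revD (rev w1) (rev y).
rewrite B36_rev b1y !revK mulmxDr !mulmxA xy mul0mx addr0 mulmxN mulmx1.
rewrite (hat_rev_anticomm b1x) mulNmx -mulmxA xy' mulmx0 oppr0.
by move/esym/eqP; rewrite oppr_eq0 => /eqP.
Qed.

(** Orthogonal vectors anticommute, so the last factor can be moved next to its twin in S, where the
    product is -Q = 0. *)
Lemma spinor_product_annih x y z :
  Q36 x = 0 -> Q36 y = 0 -> Q36 z = 0 ->
  B36 x y = 0 -> B36 x z = 0 -> B36 y z = 0 ->
  let S := hat x *m hat (rev y) *m hat z in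
  [/\ S *m hat (rev x) = 0, S *m hat (rev y) = 0 & S *m hat (rev z) = 0].
Proof.
move=> qx qy qz bxy bxz byz S.
have q0 u : Q36 u = 0 -> hat u *m hat (rev u) = 0.
  by move=> q; rewrite mulmx_hat_rev q raddf0 oppr0.
have q0' u : Q36 u = 0 -> hat (rev u) *m hat u = 0.
  by move=> q; rewrite -{2}[u]revK q0 // Q36_rev.
rewrite /S; split.
- rewrite -mulmxA (@hat_rev_anticomm z) 1?B36C // mulmxN mulmxA.
  rewrite -(mulmxA (hat x)) (@rev_hat_anticomm y) 1?B36C //.
  by rewrite mulmxN mulmxA q0 // !mul0mx !oppr0 mul0mx oppr0.
- rewrite -mulmxA (@hat_rev_anticomm z) 1?B36C // mulmxN mulmxA.
  by rewrite -(mulmxA (hat x)) q0' // mulmx0 mul0mx oppr0.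
- by rewrite -mulmxA q0 // mulmx0.
Qed.

(** The flag labels the family: [false] for s /\ F^4, [true] for its image under [rev]. *)
Definition twist (e : bool) x := if e then rev x else x.

(* [s *m hat (rev x) = 0] says that s /\ x = 0. *)
Definition annih (e : bool) s (M : 'M[F]_(3, 6)) :=
  [forall i, s *m hat (twist (~~ e) (row i M)) == 0].

Definition tsing (M : 'M[F]_(3, 6)) :=
  forall i j, B36 (row i M) (row j M) = 0 /\ Q36 (row i M) = 0.

(** The spinor is a nonzero row of the Clifford product of the three rows of M. *)
Lemma exists_annih (M : 'M[F]_(3, 6)) : row_free M -> tsing M ->
  exists e s, s != 0 /\ annih e s M.
Proof.
move=> /row_freeP[N MN] tsM.
(* The columns of a right inverse N are dual to the rows of M for the dot product; reversing them
   makes them dual for [B36]. *)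
pose r k := row (inord k) M; pose w k := rev (col (inord k) N)^T.
have bwr k l : B36 (w k) (r l) = (inord l == inord k :> 'I_3)%:R.
  have <- : (M *m N) (inord l) (inord k) = (inord l == inord k :> 'I_3)%:R.
    by rewrite MN mxE.
  rewrite [RHS]mxE /B36 (reindex_inj rev_ord_inj) /=; apply: eq_bigr => i _.
  by rewrite !mxE rev_ordK mulrC.
have bQ k : Q36 (r k) = 0 by have [] := tsM (inord k) (inord k).
have bB k l : B36 (r k) (r l) = 0 by have [] := tsM (inord k) (inord l).
have r0 : r 0 != 0.
  apply/eqP => r0; have := bwr 0 0; rewrite r0 eqxx B36E /= !mxE !mulr0 !addr0.
  by move/eqP; rewrite eq_sym oner_eq0.
have ex_row (A : 'M[F]_4) : A != 0 -> exists i, row i A != 0.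
  by move=> A0; apply/existsP; apply: contraNT A0 => /existsPn h;
    apply/eqP/row_matrixP => i; rewrite row0; apply/eqP; rewrite -[_ == _]negbK h.
have := @spinor_product_neq0 (r 0) (r 1) (r 2) (w 1) (w 2) r0.
rewrite !bwr -!val_eqE /= !inordK // => /(_ erefl erefl erefl erefl erefl).
(* The block of the product that is nonzero decides the family. *)
case/orP=> /ex_row[i Si]; [exists false | exists true];
  move: Si; set s := row i _ => s0; exists s; split=> //; apply/forallP; rewrite /s.
- have [h0 h1 h2] := spinor_product_annih (bQ 0) (bQ 1) (bQ 2) (bB 0 1) (bB 0 2) (bB 1 2).
  by elim/forall_ord3; rewrite -row_mul /= ?(h0, h1, h2) row0.
- have [] := @spinor_product_annih (rev (r 0)) (rev (r 1)) (rev (r 2));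
    rewrite ?Q36_rev ?B36_rev // !revK => h0 h1 h2.
  by elim/forall_ord3; rewrite -row_mul /= ?(h0, h1, h2) row0.
Qed.
End Spinors.

(** * The two families of singular subspaces *)

Section Wedge.
Variable F : finFieldType.
Implicit Types (x y z w : 'rV[F]_6) (s v t u : 'rV[F]_4).

Lemma rev0 : rev (0 : 'rV[F]_6) = 0.
Proof. by apply/rowP => j; rewrite !mxE. Qed.

Lemma mulmx_trE s v i j : (s^T *m v) i j = s 0 i * v 0 j.
Proof. by rewrite mxE big_ord1 mxE. Qed.

Lemma hat_wedge s v : hat (wedge s v) = s^T *m v - v^T *m s.
Proof.
apply/matrixP; elim/forall_ord4; elim/forall_ord4;
  rewrite hatE // !wedgeE // mxE mulmx_trE mxE mulmx_trE; coord_ring.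
Qed.

Lemma mulmx_hat_rev_wedge s v : s *m hat (rev (wedge s v)) = 0.
Proof.
apply/rowP; elim/forall_ord4;
  rewrite !mxE sum_ord4 !hatE // !revE //= /subn /= !wedgeE //=; coord_ring.
Qed.

(** The Koszul identity for contraction by u. When s /\ x = 0 the last term drops out, which
    exhibits a multiple of x as an element of s /\ F^4. *)
Lemma contract_wedge s x u :
  (u *m s^T) 0 0 *: x =
    wedge s (u *m hat x) + rev (wedge u (s *m hat (rev x))).
Proof.
apply/rowP; elim/forall_ord6; rewrite 2!mxE [RHS]mxE revE //= !wedgeE // 
  !mxE !sum_ord4 !hatE // !revE // !mxE; coord_ring.
Qed.

Lemma Q36_wedge s v : Q36 (wedge s v) = 0.
Proof. rewrite /Q36 !wedgeE //; coord_ring. Qed.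

Lemma B36_wedge s v v' : B36 (wedge s v) (wedge s v') = 0.
Proof. rewrite B36E !wedgeE //; coord_ring. Qed.

Lemma wedge_linear s : linear (wedge s).
Proof.
move=> a v w; apply/rowP; elim/forall_ord6;
  rewrite [RHS]mxE [X in _ = X + _]mxE !wedgeE // !mxE; coord_ring.
Qed.

HB.instance Definition _ s := GRing.isLinear.Build F 'rV[F]_4 'rV[F]_6 *:%R
  (wedge s) (wedge_linear s).

Lemma wedge_minors s v : wedge s v = 0 -> forall i j, s 0 i * v 0 j = s 0 j * v 0 i.
Proof.
move=> sv0 i j; have := congr1 (fun A : 'M_4 => A i j) (hat_wedge s v).
have -> : hat (wedge s v) i j = 0.
  have := congr1 (fun A : 'M_4 => A i j) (hatD 0 (0 : 'rV[F]_6)).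
  by rewrite addr0 sv0 [RHS]mxE -[LHS]addr0 => /addrI/esym.
rewrite mxE mulmx_trE mxE mulmx_trE => /esym/eqP; rewrite subr_eq0 => /eqP ->.
by rewrite mulrC.
Qed.

Lemma wedge_eq0 s v : s != 0 -> wedge s v = 0 -> exists c, v = c *: s.
Proof.
case/rV0Pn=> i si /wedge_minors sv; exists (v 0 i / s 0 i); apply/rowP=> j.
by rewrite mxE mulrAC -[_ * s 0 j]mulrC -sv mulrC mulKf.
Qed.

Lemma twist_linear e : linear (@twist F e).
Proof. by case: e => a x y //; apply/rowP => i; rewrite !mxE. Qed.

HB.instance Definition _ e := GRing.isLinear.Build F 'rV[F]_6 'rV[F]_6 *:%R
  (@twist F e) (twist_linear e).

Lemma twistK e : involutive (@twist F e).
Proof. by case: e => x //; apply: revK. Qed.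

Lemma twistN e x : twist (~~ e) x = rev (twist e x).
Proof. by case: e; rewrite //= revK. Qed.

Lemma Q36_twist e x : Q36 (twist e x) = Q36 x.
Proof. by case: e; rewrite // Q36_rev. Qed.

Lemma B36_twist e x y : B36 (twist e x) (twist e y) = B36 x y.
Proof. by case: e; rewrite // B36_rev. Qed.

Definition spinor_map e s v := twist e (wedge s v).

Lemma spinor_map_linear e s : linear (spinor_map e s).
Proof. by move=> a v w; rewrite /spinor_map wedge_linear twist_linear. Qed.

HB.instance Definition _ e s := GRing.isLinear.Build F 'rV[F]_4 'rV[F]_6 *:%R
  (spinor_map e s) (spinor_map_linear e s).

Lemma spinor_map_self e s : spinor_map e s s = 0.
Proof.
rewrite /spinor_map (_ : wedge s s = 0) ?linear0 //.
apply/rowP; elim/forall_ord6; rewrite wedgeE // mxE; coord_ring.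
Qed.

Lemma spinor_map_eq0 e s v : s != 0 -> spinor_map e s v = 0 -> exists c, v = c *: s.
Proof.
move=> s0 /(congr1 (twist e)); rewrite twistK => sv0; apply: (wedge_eq0 s0).
by rewrite sv0 linear0.
Qed.

Lemma annihE e s (M : 'M[F]_(3, 6)) i : annih e s M ->
  s *m hat (rev (twist e (row i M))) = 0.
Proof. by move=> /forallP/(_ i)/eqP; rewrite twistN. Qed.

Lemma annih_row e s (M : 'M[F]_(3, 6)) : s != 0 -> annih e s M ->
  exists V : 'M[F]_(3, 4), forall i, row i M = spinor_map e s (row i V).
Proof.
case/rV0Pn=> k sk an.
(* [contract_wedge] with u = e_k, whose pairing with s is s_k, divided by s_k. *)
exists (\matrix_i ((s 0 k)^-1 *: (delta_mx 0 k *m hat (twist e (row i M))))).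
move=> i; rewrite rowK linearZ /=.
have := contract_wedge s (twist e (row i M)) (delta_mx 0 k).
rewrite annihE // linear0 rev0 addr0 mxE /spinor_map.
rewrite (bigD1 k) //= big1 ?addr0 => [|j jk]; last by rewrite !mxE (negPf jk) andbF mul0r.
by rewrite !mxE !eqxx mul1r => <-; rewrite linearZ /= twistK scalerA mulVf ?scale1r.
Qed.

Lemma mulmx_spinor_map e s (M : 'M[F]_(3, 6)) (V : 'M[F]_(3, 4)) (b : 'rV[F]_3) :
  (forall i, row i M = spinor_map e s (row i V)) ->
  b *m M = spinor_map e s (b *m V).
Proof.
move=> MV; rewrite !mulmx_sum_row linear_sum; apply: eq_bigr => i _.
by rewrite linearZ MV.
Qed.

(** A relation a s + b V = 0 gives b M = s /\ (b V) = -a (s /\ s) = 0 up to [twist], so b = 0 by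
    independence of the rows of M, and then a = 0. *)
Lemma det_spinor_frame_neq0 e s (M : 'M[F]_(3, 6)) (V : 'M[F]_(3, 4)) :
  s != 0 -> row_free M -> (forall i, row i M = spinor_map e s (row i V)) ->
  \det (col_mx s V : 'M_(1 + 3)) != 0.
Proof.
move=> s0 /row_freeP[N MN] MV; apply/negP => /det0P[v v0].
rewrite -[v]hsubmxK mul_row_col; set a := lsubmx v; set b := rsubmx v => /eqP.
rewrite addrC addr_eq0 => /eqP abV.
have b0 : b = 0.
  rewrite -[b]mulmx1 -MN mulmxA (mulmx_spinor_map _ MV) abV.
  by rewrite [a]mx11_scalar mul_scalar_mx -scaleNr linearZ /= spinor_map_self
    scaler0 mul0mx.
move/eqP: abV; rewrite b0 mul0mx eq_sym oppr_eq0 [a]mx11_scalar mul_scalar_mx.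
rewrite scaler_eq0 (negPf s0) orbF => /eqP a0.
move/eqP: v0; apply; rewrite -[v]hsubmxK -/a -/b b0 [a]mx11_scalar a0.
by apply/rowP=> j; rewrite mxE; case: splitP => k _; rewrite !mxE ?mul0rn.
Qed.

Lemma row_free_rank1 (M : 'M[F]_(3, 6)) (p : 'rV[F]_6) :
  row_free M -> ~ (forall i, exists c, row i M = c *: p).
Proof.
move=> /eqP rM h.
have : (M <= p)%MS.
  by apply/row_subP => i; have [c ->] := h i; apply: scalemx_sub.
move/mxrankS; rewrite rM => le3; have := leq_trans le3 (rank_leq_row p).
by [].
Qed.

(** Within one family, independent s and s' would force every row to be a multiple of s' /\ s.
    Spinors from opposite families would make the rows vanish or the frame of s singular. *)
Lemma annih_unique e e' s s' (M : 'M[F]_(3, 6)) : row_free M ->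
  s != 0 -> s' != 0 -> annih e s M -> annih e' s' M ->
  e' = e /\ exists c, s' = c *: s.
Proof.
move=> fM s0 s'0 an an'.
have [ee'|ne] := eqVneq e' e.
  rewrite ee' in an'; split=> //.
  have [ss'|/rV0Pn] := eqVneq (wedge s s') 0; first exact: wedge_eq0 ss'.
  move=> nz; exfalso.
  have [i [j D0]] : exists i j, s 0 i * s' 0 j - s 0 j * s' 0 i != 0.
    case: nz; elim/forall_ord6; rewrite wedgeE //= => nz;
    by [exists (inord 0), (inord 1) | exists (inord 0), (inord 2)
      | exists (inord 0), (inord 3) | exists (inord 1), (inord 2)
      | exists (inord 3), (inord 1) | exists (inord 2), (inord 3)].
  (* u is orthogonal to s and pairs with s' to the nonzero minor D. Contracting with s gives u
     [hat x] = c s; contracting with s' then gives D x = c (s' /\ s). *)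
  pose u : 'rV[F]_4 := s 0 i *: delta_mx 0 j - s 0 j *: delta_mx 0 i.
  have uE (t : 'rV[F]_4) : (u *m t^T) 0 0 = s 0 i * t 0 j - s 0 j * t 0 i.
    by rewrite mulmxBl -!scalemxAl -!rowE !mxE.
  apply: (@row_free_rank1 M (twist e (wedge s' s))) => // k.
  set x := twist e (row k M).
  have := contract_wedge s x u; rewrite annihE // linear0 rev0 addr0 uE mulrC subrr scale0r.
  move/esym/(wedge_eq0 s0) => [c uc].
  have := contract_wedge s' x u; rewrite annihE // linear0 rev0 addr0 uE uc.
  move: D0; set D := (_ - _) => D0 Dx.
  exists (D^-1 * c); rewrite -[row k M](twistK e) -/x -[x](scalerK D0) // Dx.
  by rewrite -scalerA linearZ /= linearZ /= linearZ.
exfalso; have {ne} ee' : e' = ~~ e by move: e e' ne {an an'} => [] [].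
have [V MV] := annih_row s0 an.
(* Expand s' [hat (s /\ v)] = 0 by [hat_wedge]. If s'.s is nonzero, v is a multiple of s and the row
   vanishes; otherwise s' is orthogonal to s and to all rows of V. *)
have hx k : (s' *m s^T) 0 0 *: row k V = (s' *m (row k V)^T) 0 0 *: s.
  rewrite -!mul_scalar_mx -!mx11_scalar; apply/eqP.
  rewrite -subr_eq0 -!mulmxA -mulmxBr -hat_wedge.
  move: an' => /forallP/(_ k); rewrite ee' negbK MV /spinor_map twistK.
  by [].
have [ts|ts] := eqVneq ((s' *m s^T) 0 0) 0; last first.
  apply: (@row_free_rank1 M 0) => // k; exists 0; rewrite MV scaler0.
  by rewrite -[row k V](scalerK ts) hx !linearZ /= spinor_map_self !scaler0.
have frame0 : (col_mx s V : 'M_(1 + 3, _)) *m s'^T = 0.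
  rewrite mul_col_mx; apply/trmx_inj; rewrite tr_col_mx !trmx_mul trmxK trmx0.
  rewrite [s' *m s^T]mx11_scalar ts raddf0.
  apply/rowP=> j; rewrite [RHS]mxE mxE; case: splitP => k _; rewrite ?mxE //.
  move: (hx k); rewrite ts scale0r => /esym/eqP; rewrite scaler_eq0 (negPf s0) orbF.
  by move=> /eqP h; rewrite -[RHS]h [RHS]mxE; apply: eq_bigr => l _; rewrite !mxE.
have uf : (col_mx s V : 'M_(1 + 3)) \in unitmx.
  by rewrite unitmxE unitfE; apply: det_spinor_frame_neq0 MV.
move/eqP: s'0; apply; apply: trmx_inj; rewrite trmx0.
by rewrite -[LHS](mulKmx uf) frame0 mulmx0.
Qed.
End Wedge.

(** * Minors as quadratic forms in the spinor *)

Section Minors.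
Variable F : finFieldType.
Implicit Types (x y z w : 'rV[F]_6) (s v t u : 'rV[F]_4).

(* [Some (b, i, j)] encodes (-1)^b s_i s_j, the quotient by [frame_det] of the
   minor of columns a < b < c in the first family. *)
Definition minor_monomial (a b c : nat) : option (bool * nat * nat) :=
  match a, b, c with
  | 0, 1, 2 => Some (false, 0, 0)
  | 0, 1, 4 => Some (true, 0, 1)
  | 0, 1, 5 => Some (false, 0, 2)
  | 0, 2, 3 => Some (true, 0, 1)
  | 0, 2, 5 => Some (false, 0, 3)
  | 0, 3, 4 => Some (true, 1, 1)
  | 0, 3, 5 => Some (false, 1, 2)
  | 0, 4, 5 => Some (true, 1, 3)
  | 1, 2, 3 => Some (true, 0, 2)
  | 1, 2, 4 => Some (false, 0, 3)
  | 1, 3, 4 => Some (true, 1, 2)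
  | 1, 3, 5 => Some (false, 2, 2)
  | 1, 4, 5 => Some (true, 2, 3)
  | 2, 3, 4 => Some (true, 1, 3)
  | 2, 3, 5 => Some (false, 2, 3)
  | 2, 4, 5 => Some (true, 3, 3)
  | _, _, _ => None
  end%N.

Definition twisted_monomial (e : bool) (a b c : nat) :=
  if e then minor_monomial (5 - c) (5 - b) (5 - a) else minor_monomial a b c.

Definition monomial_mx (m : option (bool * nat * nat)) : 'M[F]_4 :=
  if m is Some (b, i, j) then (-1) ^+ b *: delta_mx (inord i) (inord j) else 0.

(** [rev] reverses the order of the three columns, an odd permutation; hence the sign (-1)^e. *)
Definition minor_form (e : bool) (a b c : nat) : 'M[F]_4 :=
  (-1) ^+ e *: monomial_mx (twisted_monomial e a b c).

Lemma qform_delta s i j : (s *m delta_mx i j *m s^T) 0 0 = s 0 i * s 0 j.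
Proof.
rewrite !mxE (bigD1 j) //= big1 ?addr0 => [|k kj]; last first.
  rewrite mxE big1 ?mul0r // => l _.
  by rewrite !mxE (negPf kj) andbF mulr0.
rewrite !mxE (bigD1 i) //= big1 ?addr0 => [|k ki]; last first.
  by rewrite !mxE (negPf ki) mulr0.
by rewrite !mxE !eqxx mulr1.
Qed.

Definition columns_minor (x y z : 'rV[F]_6) (a b c : nat) : F :=
  x^[a] * (y^[b] * z^[c] - y^[c] * z^[b])
  - x^[b] * (y^[a] * z^[c] - y^[c] * z^[a])
  + x^[c] * (y^[a] * z^[b] - y^[b] * z^[a]).

Definition column (I : subset36) (j : nat) : nat := nth ord0 (enum (val I)) j.

Lemma detI_columns_minor (I : subset36) (M : 'M[F]_(3, 6)) :
  detI I M =
    columns_minor (row (inord 0) M) (row (inord 1) M) (row (inord 2) M)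
      (column I 0) (column I 1) (column I 2).
Proof.
rewrite /detI.
have -> : colsub (fun j : 'I_3 => nth ord0 (enum (val I)) j) M =
    \matrix_(i, j) (row (inord i) M)^[column I j].
  by apply/matrixP=> i j; rewrite !mxE !inord_val.
exact: (det_matrix3 (fun i j => (row (inord i) M)^[column I j])).
Qed.

Lemma sorted_enum_ord n (A : {set 'I_n}) : sorted ltn [seq val i | i <- enum A].
Proof.
rewrite sorted_map /enum_mem; apply: sorted_filter; last first.
  by rewrite -sorted_map -enumT val_enum_ord iota_ltn_sorted.
by move=> ? ? ?; apply: ltn_trans.
Qed.

Lemma column_lt (I : subset36) :
  [&& column I 0 < column I 1, column I 1 < column I 2 & column I 2 < 6]%N.
Proof.
rewrite ltn_ord andbT /column.
have sz : size (enum (val I)) = 3 by rewrite -cardE; exact/eqP/(valP I).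
have := sorted_enum_ord (val I).
by case: (enum _) sz => [|? [|? [|? []]]] //= _; rewrite andbT.
Qed.

Lemma columns_minor_twist e x y z a b c : (a < 6)%N -> (b < 6)%N -> (c < 6)%N ->
  columns_minor (twist e x) (twist e y) (twist e z) a b c =
  (-1) ^+ e * (if e then columns_minor x y z (5 - c) (5 - b) (5 - a)
               else columns_minor x y z a b c).
Proof.
case: e => /= la lb lc; last by rewrite expr0 mul1r.
rewrite /columns_minor /= !revE //; ring.
Qed.

Definition frame_det s v1 v2 v3 : F :=
  let m (i j k : nat) := v1^[i] * (v2^[j] * v3^[k] - v2^[k] * v3^[j])
      - v1^[j] * (v2^[i] * v3^[k] - v2^[k] * v3^[i])
      + v1^[k] * (v2^[i] * v3^[j] - v2^[j] * v3^[i]) in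
  s^[0] * m 1%N 2%N 3%N - s^[1] * m 0%N 2%N 3%N
  + s^[2] * m 0%N 1%N 3%N - s^[3] * m 0%N 1%N 2%N.

Lemma det_frame s (V : 'M[F]_(3, 4)) :
  \det (col_mx s V : 'M_(1 + 3)) =
  frame_det s (row (inord 0) V) (row (inord 1) V) (row (inord 2) V).
Proof.
pose g i j := if i is k.+1 then (row (inord k) V)^[j] else s^[j].
have -> : (col_mx s V : 'M_(1 + 3)) = \matrix_(i < 4, j < 4) g i j.
  apply/matrixP => i j; rewrite [RHS]mxE mxE.
  case: splitP => k ->; first by rewrite (ord1 k) /g inord_val.
  by rewrite /g /= mxE !inord_val.
rewrite det_matrix4.
under eq_bigr => k _.
  rewrite (det_matrix3 (fun i j => g i.+1 (bump k j))).
  over.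
rewrite sum_ord4 /= !inordK // /bump /= /frame_det; ring.
Qed.

(** For fixed s the minor is alternating in v1, v2, v3 and depends on them only modulo s, so it is a
    multiple of the determinant of s, v1, v2, v3; the factor is quadratic in s. The twenty column
    triples are checked one by one. *)
Lemma wedge_columns_minor s v1 v2 v3 a b c : (a < b)%N -> (b < c)%N -> (c < 6)%N ->
  columns_minor (wedge s v1) (wedge s v2) (wedge s v3) a b c =
  (s *m monomial_mx (minor_monomial a b c) *m s^T) 0 0 * frame_det s v1 v2 v3.
Proof.
move=> ab bc c6.
have h (i : option (bool * nat * nat)) : (s *m monomial_mx i *m s^T) 0 0 =
   if i is Some (b, i, j) then (-1) ^+ b * (s^[i] * s^[j]) else 0.
  case: i => [[[b' i] j]|] /=.
    by rewrite -scalemxAr -scalemxAl mxE qform_delta.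
  by rewrite mulmx0 mul0mx mxE.
case: c bc c6 => [|[|[|[|[|[|c]]]]]] //; case: b ab => [|[|[|[|[|b]]]]] //;
  case: a => [|[|[|[|a]]]] // _ _ _.
all: rewrite h /columns_minor !wedgeE //= /frame_det ?expr0 ?expr1.
all: coord_ring.
Qed.
(** Arbitrary matrices, rather than symmetric ones, represent every quadratic form in characteristic
    2 as well. *)
Definition qf (k : nat) (A : 'M[F]_k) (s : 'rV[F]_k) : F := (s *m A *m s^T) 0 0.

Definition spinor_form (e : bool) (f : Delta36 F) : 'M[F]_4 :=
  \sum_(I : subset36)
    f I *: minor_form e (column I 0) (column I 1) (column I 2).

Lemma qf_sum (T : finType) (c : T -> F) (A : T -> 'M[F]_4) s :
  qf (\sum_i c i *: A i) s = \sum_i c i * qf (A i) s.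
Proof.
rewrite /qf mulmx_sumr mulmx_suml summxE; apply: eq_bigr => i _.
by rewrite -scalemxAr -scalemxAl mxE.
Qed.

Lemma spinor_columns_minor e s v1 v2 v3 a b c :
  (a < b)%N -> (b < c)%N -> (c < 6)%N ->
  columns_minor (spinor_map e s v1) (spinor_map e s v2) (spinor_map e s v3) a b c =
  qf (minor_form e a b c) s * frame_det s v1 v2 v3.
Proof.
move=> ab bc c6; have b6 := ltn_trans bc c6; have a6 := ltn_trans ab b6.
rewrite columns_minor_twist // /qf /minor_form /twisted_monomial.
rewrite -scalemxAr -scalemxAl mxE -mulrA; congr (_ * _).
case: e; rewrite wedge_columns_minor //; lia.
Qed.

Lemma evalDelta_spinor e s (M : 'M[F]_(3, 6)) (V : 'M[F]_(3, 4)) f :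
  (forall i, row i M = spinor_map e s (row i V)) ->
  evalDelta f M = qf (spinor_form e f) s * \det (col_mx s V : 'M_(1 + 3)).
Proof.
move=> MV; rewrite /evalDelta /spinor_form qf_sum mulr_suml det_frame.
apply: eq_bigr => I _; have /and3P[k01 k12 k26] := column_lt I.
by rewrite detI_columns_minor !MV spinor_columns_minor // mulrA.
Qed.

(** The choice of matrix for a given row space only affects the nonzero frame determinant. *)
Lemma evalDelta_neq0 e s (M : 'M[F]_(3, 6)) f :
  row_free M -> s != 0 -> annih e s M ->
  (evalDelta f M != 0) = (qf (spinor_form e f) s != 0).
Proof.
move=> fM s0 /(annih_row s0)[V MV].
by rewrite (evalDelta_spinor f MV) mulf_eq0 (negPf (det_spinor_frame_neq0 s0 fM MV)) orbF.
Qed.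

(** Off the diagonal this is the other pair of indices in {0,1,2,3}; diagonal pairs are fixed, since
    [monomial_cross] is false on them. *)
Definition complement_pair (k l : nat) : nat * nat :=
  let r := [seq i <- iota 0 4 | (i != k) && (i != l)] in
  if k == l then (k, k) else (nth 0 r 0, nth 0 r 1)%N.

(** The (k,l) entry modulo 2 of the polar form of s_i s_j; the exclusive or cancels the contribution
    2 of a square. *)
Definition monomial_cross (m : option (bool * nat * nat)) (k l : nat) : bool :=
  if m is Some (_, i, j) then
    ((i == k) && (j == l)) (+) ((i == l) && (j == k))
  else false.

(* In even characteristic this ties the polar forms of the two quadratic forms
   attached to one codeword. *)
Lemma twisted_monomial_complement e a b c k l :
  (a < b)%N -> (b < c)%N -> (c < 6)%N -> (k < 4)%N -> (l < 4)%N ->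
  monomial_cross (twisted_monomial e a b c) k l =
  monomial_cross (twisted_monomial (~~ e) a b c)
    (complement_pair k l).1 (complement_pair k l).2.
Proof.
move=> ab bc c6 k4 l4.
case: c bc c6 => [|[|[|[|[|[|c]]]]]] //; case: b ab => [|[|[|[|[|b]]]]] //;
  case: a => [|[|[|[|a]]]] // _ _ _.
all: by case: k k4 => [|[|[|[|k]]]] // _; case: l l4 => [|[|[|[|l]]]] // _; case: e.
Qed.

Lemma complement_pair_lt k l : (k < 4)%N -> (l < 4)%N ->
  ((complement_pair k l).1 < 4)%N && ((complement_pair k l).2 < 4)%N.
Proof. by case: k => [|[|[|[|k]]]] // _; case: l => [|[|[|[|l]]]]. Qed.

Lemma monomial_mx_polar m k l : 2%:R = 0 :> F -> (k < 4)%N -> (l < 4)%N ->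
  (if m is Some (_, i, j) then (i < 4)%N && (j < 4)%N else true) ->
  (monomial_mx m + (monomial_mx m)^T) (inord k) (inord l) = (monomial_cross m k l)%:R.
Proof.
move=> two0 k4 l4; case: m => [[[b i] j]|] /=; last by rewrite !mxE addr0.
case/andP=> i4 j4.
have -> : (-1) ^+ b = 1 :> F.
  by case: b => //; rewrite expr1; apply/eqP; rewrite eq_sym -subr_eq0 opprK -mulr2n two0.
rewrite !scale1r !mxE -!val_eqE /= !inordK //.
rewrite ![k == _]eq_sym ![l == _]eq_sym.
case: (i == k); case: (j == l); case: (i == l); case: (j == k);
  by rewrite /= ?addr0 ?add0r // -mulr2n two0.
Qed.

Lemma twisted_monomial_lt e a b c :
  if twisted_monomial e a b c is Some (_, i, j) then (i < 4)%N && (j < 4)%N else true.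
Proof.
have h (x y z : nat) : if minor_monomial x y z is Some (_, i, j)
               then (i < 4)%N && (j < 4)%N else true.
  by case: x => [|[|[|[|x]]]] //; case: y => [|[|[|[|[|y]]]]] //;
    case: z => [|[|[|[|[|[|z]]]]]].
rewrite /twisted_monomial; case: e.
  by have := h (5 - c)%N (5 - b)%N (5 - a)%N; case: minor_monomial => [[[]]|].
by have := h a b c; case: minor_monomial => [[[]]|].
Qed.

Definition polar (k : nat) (A : 'M[F]_k) := A + A^T.

(** Signs disappear in characteristic 2, so each entry of one polar matrix equals the entry of the
    other at the complementary pair. *)
Lemma spinor_form_polar_eq0 e f : 2%:R = 0 :> F ->
  polar (spinor_form (~~ e) f) = 0 -> polar (spinor_form e f) = 0.
Proof.
move=> two0 p0; apply/matrixP => k l; rewrite -[k]inord_val -[l]inord_val.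
have polarE e' k' l' : (k' < 4)%N -> (l' < 4)%N ->
    polar (spinor_form e' f) (inord k') (inord l') =
    \sum_I f I * (monomial_cross
      (twisted_monomial e' (column I 0) (column I 1) (column I 2)) k' l')%:R.
  move=> k4 l4; rewrite /polar mxE [X in _ + X]mxE !summxE -big_split.
  apply: eq_bigr => I _; rewrite -(@monomial_mx_polar _ k' l') ?twisted_monomial_lt //.
  have -> : minor_form e' (column I 0) (column I 1) (column I 2) = monomial_mx
      (twisted_monomial e' (column I 0) (column I 1) (column I 2)).
    rewrite /minor_form; case: e'; last by rewrite expr0 scale1r.
    rewrite expr1; have -> : -1 = 1 :> F.
      by apply/eqP; rewrite eq_sym -subr_eq0 opprK -mulr2n two0.
    by rewrite scale1r.
  by rewrite /= mxE [X in _ + X]mxE [in RHS]mxE mulrDr !mxE.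
have /andP[k'4 l'4] := complement_pair_lt (ltn_ord k) (ltn_ord l).
rewrite polarE // [RHS]mxE.
transitivity (polar (spinor_form (~~ e) f) (inord (complement_pair k l).1)
   (inord (complement_pair k l).2)); last by rewrite p0 mxE.
rewrite polarE //; apply: eq_bigr => I _; have /and3P[k01 k12 k26] := column_lt I.
by rewrite -twisted_monomial_complement.
Qed.
End Minors.

(** * Zeros of quadratic forms *)

Section QuadraticForms.
Variables (F : finFieldType) (k : nat).
Implicit Types (A : 'M[F]_k) (x y z u : 'rV[F]_k).

Definition bil A x y : F := (x *m polar A *m y^T) 0 0.

Lemma bilDl A x y z : bil A (x + y) z = bil A x z + bil A y z.
Proof. by rewrite /bil !mulmxDl mxE. Qed.

Lemma bilZl A c x z : bil A (c *: x) z = c * bil A x z.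
Proof. by rewrite /bil -!scalemxAl mxE. Qed.

Lemma bilZr A c x z : bil A x (c *: z) = c * bil A x z.
Proof. by rewrite /bil linearZ /= -scalemxAr mxE. Qed.

Lemma qfZ A c x : qf A (c *: x) = c ^+ 2 * qf A x.
Proof. by rewrite /qf linearZ /= -!scalemxAl -scalemxAr !mxE mulrA. Qed.

Lemma qfD A x y : qf A (x + y) = qf A x + qf A y + bil A x y.
Proof.
have yx : (y *m A *m x^T) 0 0 = (x *m A^T *m y^T) 0 0.
  have <- : (y *m A *m x^T)^T = x *m A^T *m y^T by rewrite !trmx_mul trmxK mulmxA.
  by rewrite [RHS]mxE.
rewrite /qf /bil /polar linearD /= !mulmxDl !mulmxDr !mulmxDl !mxE.
move: yx; rewrite !mxE => ->; ring.
Qed.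

Lemma bil_self A u : qf A u = 0 -> bil A u u = 0.
Proof.
move=> u0; have := qfD A u u; rewrite u0 !add0r => <-.
by rewrite -[u]scale1r -scalerDl qfZ u0 mulr0.
Qed.

(** The map (c, z) |-> z + c u is injective on F x Z and lands in S. *)
Lemma card_translates (S Z : {set 'rV[F]_k}) u :
  (forall c z, z \in Z -> z + c *: u \in S) ->
  (forall c z, z \in Z -> z + c *: u \in Z -> c = 0) ->
  (#|F| * #|Z| <= #|S|)%N.
Proof.
move=> ZS Zc; rewrite -cardsT -cardsX.
rewrite -(@card_in_imset _ _ (fun p : F * 'rV[F]_k => p.2 + p.1 *: u)).
  by apply/subset_leq_card/subsetP => _ /imsetP[[c z] /setXP[_ zZ] ->]; apply: ZS.
move=> [c z] [c' z'] /setXP[_ /= zZ] /setXP[_ /= z'Z] /= e.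
have zE : z = z' + (c' - c) *: u.
  by rewrite scalerBl addrA -e addrK.
have /eqP : c' - c = 0 by apply: (Zc _ z') => //; rewrite -zE.
by rewrite subr_eq0 => /eqP cc; rewrite zE cc subrr scale0r addr0.
Qed.

(** Every zero z is in the radical, so the form at z + c x0 is c^2 times its value at x0. Hence
    zeros have disjoint translates along x0 and number at most q^(k-1). *)
Lemma card_qf_neq0_radical A :
  (forall u x, qf A u = 0 -> bil A x u = 0) -> (exists x, qf A x != 0) ->
  ((#|F| - 1) * #|F| ^ k <= #|F| * #|[set x | qf A x != 0%R]|)%N.
Proof.
move=> rad [x0 x00]; set P := [set x | _].
have : (#|F| * #|~: P| <= #|[set: 'rV[F]_k]|)%N.
  apply: (@card_translates _ _ x0) => [c z _|c z]; first by rewrite inE.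
  rewrite !inE !negbK => /eqP z0; rewrite addrC qfD qfZ z0 addr0.
  rewrite bilZl rad // mulr0 addr0 mulf_eq0 (negPf x00) orbF expf_eq0 /=.
  by move/eqP.
rewrite cardsT; have := cardsC P; rewrite card_mx mul1n => <-.
move: #|F| #|P| #|~: P| => q p z; nia.
Qed.

(* Given a singular u outside the radical, each line of direction u on which
   [bil A _ u] does not vanish contains exactly one zero. *)
Lemma card_qf_neq0 A : (exists x, qf A x != 0) ->
  ((#|F| - 1) ^ 2 * #|F| ^ k <= #|F| ^ 2 * #|[set x | qf A x != 0%R]|)%N.
Proof.
move=> nz; have q1 := finNzRing_gt1 F.
have [rad|] := boolP [forall u, forall x, (qf A u == 0) ==> (bil A x u == 0)].
  have : ((#|F| - 1) * #|F| ^ k <= #|F| * #|[set x | qf A x != 0%R]|)%N.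
    apply: card_qf_neq0_radical nz.
    by move=> u x u0; move/forallP/(_ u)/forallP/(_ x): rad; rewrite u0 eqxx => /eqP.
  set X := (#|F| ^ k)%N; set Y := #|_ : {set _}|; nia.
case/forallPn=> u /forallPn[x0]; rewrite negb_imply => /andP[/eqP u0 xu].
pose S := [set x | bil A x u != 0]; pose Z := [set x in S | qf A x == 0].
(* The complement of [S] is the hyperplane orthogonal to u, which does not contain x0. *)
have K : (#|F| * #|~: S| <= #|F| ^ k)%N.
  have <- : #|[set: 'rV[F]_k]| = (#|F| ^ k)%N by rewrite cardsT card_mx mul1n.
  apply: (@card_translates _ _ x0) => [c z _|c z]; first by rewrite inE.
  rewrite !inE !negbK => /eqP z0; rewrite bilDl z0 add0r bilZl mulf_eq0 (negPf xu).
  by rewrite orbF => /eqP.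
have ZS : (#|F| * #|Z| <= #|S|)%N.
  apply: (@card_translates _ _ u) => c z; rewrite !inE => /andP[zu /eqP z0].
    by rewrite bilDl bilZl bil_self // mulr0 addr0.
  rewrite qfD z0 qfZ u0 mulr0 !add0r bilZr mulf_eq0 (negPf zu) orbF.
  by case/andP=> _ /eqP.
have SP : (#|S| - #|Z| <= #|[set x | qf A x != 0%R]|)%N.
  rewrite -(cardsID [set x | qf A x == 0] S) (_ : S :&: _ = Z).
    rewrite addKn subset_leq_card //; apply/subsetP => x; rewrite !inE.
    by case/andP.
  by apply/setP => x; rewrite !inE.
have := cardsC S; rewrite card_mx mul1n; move: K ZS SP.
set N := (#|F| ^ k)%N; set P := #|[set x | _]|.
move: #|S| #|Z| #|~: S| => s z s' K ZS SP NE.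
(* In sum, |S| >= (1 - 1/q) q^k and P >= (1 - 1/q) |S|. *)
have h1 : ((#|F| - 1) * N <= #|F| * s)%N by nia.
have h2 : ((#|F| - 1) * s <= #|F| * P)%N by nia.
apply: (@leq_trans ((#|F| - 1) * (#|F| * s))); 
  first by rewrite expnS expn1 -mulnA leq_mul2l h1 orbT.
by rewrite mulnCA expnS expn1 -mulnA leq_mul2l h2 orbT.
Qed.

(** The polar form is read off the values of the form at e_i, e_j and e_i + e_j. *)
Lemma polar_eq0 A : (forall x, qf A x = 0) -> polar A = 0.
Proof.
move=> A0; apply/matrixP => i j; rewrite [RHS]mxE.
have := qfD A (delta_mx 0 i) (delta_mx 0 j); rewrite !A0 !add0r => /esym.
by rewrite /bil -rowE trmx_delta -colE !mxE.
Qed.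

End QuadraticForms.

(** * Weights of codewords *)

Section Code.
Variable F : finFieldType.
Implicit Types (s v : 'rV[F]_4) (M : 'M[F]_(3, 6)) (e : bool).

Lemma rowspace_sub m n (M : 'M[F]_(m, n)) (W : {vspace 'rV[F]_n}) :
  (forall i, row i M \in W) -> (rowspace M <= W)%VS.
Proof. by move=> MW; apply/span_subvP => _ /mapP[i _ ->]. Qed.

Lemma row_mem_rowspace m n (M : 'M[F]_(m, n)) i : row i M \in rowspace M.
Proof. by apply/memv_span/map_f; rewrite mem_enum. Qed.

Lemma O36_row_free M : O36 (rowspace M) -> row_free M.
Proof.
case=> dimM _; apply: inj_row_free => b bM.
pose X := mktuple (fun i => row i M).
have /freeP fX : free X by rewrite /free size_tuple; apply/eqP.
apply/rowP=> i; rewrite mxE; apply: (fX (fun i => b 0 i)).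
rewrite -[RHS]bM mulmx_sum_row; apply: eq_bigr => j _.
by rewrite -tnth_nth tnth_mktuple.
Qed.

Lemma O36_tsing M : O36 (rowspace M) -> tsing M.
Proof. by case=> _ h i j; apply: h; apply: row_mem_rowspace. Qed.

Definition spinor_space e s : {vspace 'rV[F]_6} := limg (linfun (spinor_map e s)).

Lemma mem_spinor_space e s x :
  reflect (exists v, x = spinor_map e s v) (x \in spinor_space e s).
Proof.
apply: (iffP memv_imgP) => [[v _ ->]|[v ->]]; exists v; rewrite ?lfunE ?memvf //.
Qed.

(** The kernel of v |-> s /\ v is the line of s, so the image has dimension 4 - 1. *)
Lemma O36_spinor_space e s : s != 0 -> O36 (spinor_space e s).
Proof.
move=> s0; split; last first.
  move=> _ _ /mem_spinor_space[v ->] /mem_spinor_space[w ->].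
  by rewrite B36_twist B36_wedge Q36_twist Q36_wedge.
have kerE : lker (linfun (spinor_map e s)) = <[s]>%VS.
  apply/vspaceP => v; rewrite memv_ker lfunE; apply/eqP/vlineP.
    exact: spinor_map_eq0.
  by case=> c ->; rewrite linearZ /= spinor_map_self scaler0.
have := limg_ker_dim (linfun (spinor_map e s)) fullv.
rewrite capfv kerE dim_vline s0 dimvf dim_matrix.
by rewrite -/(spinor_space e s) => -[].
Qed.

Lemma annih_rowspace e s M : s != 0 -> O36 (rowspace M) ->
  annih e s M <-> rowspace M = spinor_space e s.
Proof.
move=> s0 OM; split=> [an|MW].
  apply/eqP; rewrite eqEdim; case: (OM) (O36_spinor_space e s0) => -> _ [-> _].
  rewrite leqnn andbT; apply: rowspace_sub => i; apply/mem_spinor_space.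
  by have [V MV] := annih_row s0 an; exists (row i V).
apply/forallP => i; have := row_mem_rowspace M i; rewrite MW.
case/mem_spinor_space => v ->; rewrite twistN /spinor_map twistK.
by rewrite mulmx_hat_rev_wedge.
Qed.

Variables (n : nat) (L : n.-tuple 'M[F]_(3, 6)).
Hypothesis hL : representatives L.

Definition spinors (i : 'I_n) : {set bool * 'rV[F]_4} :=
  [set p | (p.2 != 0) && annih p.1 p.2 (tnth L i)].

(** By existence and uniqueness, these are the nonzero multiples of one spinor in one family. *)
Lemma card_spinors i : #|spinors i| = (#|F| - 1)%N.
Proof.
have Oi := hL.1 i; have fi := O36_row_free Oi.
have [e [s [s0 an]]] := exists_annih fi (O36_tsing Oi).
have -> : spinors i = [set (e, c *: s) | c in [set~ 0]].
  apply/setP => -[e' s']; rewrite inE /=; apply/andP/imsetP.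
    case=> s'0 an'; have [-> [c sc]] := annih_unique fi s0 s'0 an an'.
    exists c; rewrite ?sc // !inE; apply: contraNneq s'0 => c0.
    by rewrite sc c0 scale0r.
  case=> c; rewrite !inE => c0 [-> ->]; rewrite scaler_eq0 negb_or c0 s0.
  split=> //; apply/forallP => j; have /forallP/(_ j)/eqP an0 := an.
  by rewrite -scalemxAl an0 scaler0.
rewrite card_in_imset ?cardsC1 ?subn1 // => c c' _ _ [].
move/eqP; rewrite -subr_eq0 -scalerBl scaler_eq0 (negPf s0) orbF subr_eq0.
by move/eqP.
Qed.

Lemma spinors_cover (p : bool * 'rV[F]_4) : p.2 != 0 ->
  exists i, forall j, (p \in spinors j) = (j == i).
Proof.
case: p => e s /= s0; have [i [Wi iu]] := hL.2 _ (O36_spinor_space e s0).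
exists i => j; rewrite inE /= s0 /=; apply/idP/eqP => [|->].
  by move/(annih_rowspace _ s0 (hL.1 j)).1/iu.
exact/(annih_rowspace _ s0 (hL.1 i)).2.
Qed.

(** Double counting of pairs (e, s) with nonzero form value: the sets [spinors i] partition the
    pairs with s nonzero, have q - 1 elements each, and any member decides whether coordinate i
    vanishes. *)
Lemma weight_spinors f :
  ((#|F| - 1) * hamming_weight (evL L f) =
  \sum_(e : bool) #|[set s | qf (spinor_form e f) s != 0%R]|)%N.
Proof.
rewrite /hamming_weight mulnC -sum_nat_const.
transitivity (\sum_(i | evL L f 0%R i != 0%R) #|spinors i|)%N.
  by apply: eq_big => [i|i _]; rewrite ?inE ?card_spinors.
transitivity (\sum_(p : bool * 'rV[F]_4 | qf (spinor_form p.1 f) p.2 != 0%R) 1)%N.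
  transitivity (\sum_(i | evL L f 0%R i != 0%R)
      \sum_(p : bool * 'rV[F]_4 | qf (spinor_form p.1 f) p.2 != 0%R)
      (p \in spinors i))%N.
    apply: eq_bigr => i fi; rewrite -sum1_card big_mkcond [RHS]big_mkcond /=.
    apply: eq_bigr => p _; case: ifP => [|_]; last by case: ifP.
    rewrite inE => /andP[p0 an].
    rewrite -(evalDelta_neq0 f (O36_row_free (hL.1 i)) p0 an).
    by move: fi; rewrite mxE => ->.
  rewrite exchange_big; apply: eq_bigr => p fp /=.
  have p0 : p.2 != 0.
    by apply: contraNneq fp => ->; rewrite /qf !mul0mx mxE.
  have [i pi] := spinors_cover p0.
  rewrite (bigD1 i) /=.
    rewrite pi eqxx big1 // => j /andP[_ ji]; by rewrite pi (negPf ji).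
  have: p \in spinors i by rewrite pi.
  rewrite inE => /andP[_ an]; rewrite mxE.
  by rewrite (evalDelta_neq0 f (O36_row_free (hL.1 i)) p0 an).
rewrite -(pair_big_dep predT (fun e s => qf (spinor_form e f) s != 0%R) (fun _ _ => 1%N)) /=.
by apply: eq_bigr => e _; rewrite -sum1_card; apply: eq_bigl => s; rewrite inE.
Qed.

Lemma card_qf_zero (A : 'M[F]_4) : (forall s, qf A s = 0) ->
  #|[set s | qf A s != 0%R]| = 0%N.
Proof.
by move=> A0; apply/eqP; rewrite cards_eq0; apply/eqP/setP => s; rewrite !inE A0 eqxx.
Qed.

Lemma card_qf4_neq0 (A : 'M[F]_4) : (exists x, qf A x != 0) ->
  ((#|F| - 1) ^ 2 * #|F| ^ 2 <= #|[set x | qf A x != 0%R]|)%N.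
Proof.
move=> /card_qf_neq0; have := finNzRing_gt1 F; move: #|F| #|_ : {set _}| => q P.
move=> q1; rewrite -[4%N]/(2 + 2)%N expnD; set Q := (q ^ 2)%N.
have : (0 < Q)%N by rewrite expn_gt0; lia.
by move=> Q0; rewrite mulnCA leq_pmul2l.
Qed.

Lemma card_qf4_neq0_polar (A : 'M[F]_4) : polar A = 0 -> (exists x, qf A x != 0) ->
  ((#|F| - 1) * #|F| ^ 3 <= #|[set x | qf A x != 0%R]|)%N.
Proof.
move=> A0 /card_qf_neq0_radical h.
have {h} : ((#|F| - 1) * #|F| ^ 4 <= #|F| * #|[set x | qf A x != 0%R]|)%N.
  by apply: h => u x _; rewrite /bil A0 mulmx0 mul0mx mxE.
have := finNzRing_gt1 F; move: #|F| #|_ : {set _}| => q P q1.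
by rewrite expnS mulnCA leq_pmul2l; lia.
Qed.

Lemma evL_neq0_spinor f : evL L f != 0 ->
  exists e s, qf (spinor_form e f) s != 0.
Proof.
case/rV0Pn=> i; rewrite mxE => fi; have fr := O36_row_free (hL.1 i).
have [e [s [s0 an]]] := exists_annih fr (O36_tsing (hL.1 i)).
by exists e, s; rewrite -(evalDelta_neq0 f fr s0 an).
Qed.

Lemma weight_ge f : evL L f != 0 ->
  (#|F| ^ 3 - #|F| ^ 2 <= hamming_weight (evL L f))%N.
Proof.
move=> /evL_neq0_spinor[e nz]; have q1 := finNzRing_gt1 F.
have := card_qf4_neq0 nz; have := weight_spinors f.
rewrite (bigD1 e) //=; move: #|F| q1 (hamming_weight _) => q q1 w.
move: #|_ : {set _}| (\sum_(_ | _) _)%N => P S wE PE.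
(* The left side is (q-1)^2 q^2, the bound for one nonzero form; the other family only adds to
   it. *)
have : ((q - 1) * (q ^ 3 - q ^ 2) <= (q - 1) * w)%N.
  by apply: (@leq_trans P); [move: PE; rewrite !expnS expn0; nia | lia].
by rewrite leq_pmul2l //; lia.
Qed.

Lemma weight_ge_even f : 2%:R = 0 :> F -> evL L f != 0 ->
  (#|F| ^ 3 <= hamming_weight (evL L f))%N.
Proof.
move=> two0 /evL_neq0_spinor[e nz]; have q1 := finNzRing_gt1 F.
have := weight_spinors f; rewrite (bigD1 e) //= (bigD1 (~~ e)) /=; last by case: e {nz}.
have : ((#|F| - 1) * #|F| ^ 3 <= #|[set s | qf (spinor_form e f) s != 0%R]|
  + #|[set s | qf (spinor_form (~~ e) f) s != 0%R]|)%N.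
  have [/existsP nz'|] := boolP [exists s, qf (spinor_form (~~ e) f) s != 0].
    have := card_qf4_neq0 nz; have := card_qf4_neq0 nz'.
    (* Both forms contribute at least (q-1)^2 q^2, and 2(q-1) >= q. *)
    move: #|F| q1 => q q1; rewrite !expnS expn0; nia.
  move/existsPn => z; apply: (leq_trans (card_qf4_neq0_polar _ nz)); last exact: leq_addr.
  apply: (spinor_form_polar_eq0 two0); apply: polar_eq0 => s.
  by apply/eqP; rewrite -[_ == _]negbK.
move: #|F| q1 (hamming_weight _) => q q1 w.
move: #|_ : {set _}| #|_ : {set _}| (\sum_(_ | _) _)%N => P P' S PE wE.
have : ((q - 1) * q ^ 3 <= (q - 1) * w)%N by lia.
by rewrite leq_pmul2l //; lia.
Qed.

End Code.

(** * Codewords attaining the bounds *)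

Section Examples.
Variable F : finFieldType.
Implicit Types (s : 'rV[F]_4) (e : bool).

Lemma exists_column a b c : (a < b)%N -> (b < c)%N -> (c < 6)%N ->
  exists I : subset36, [/\ column I 0 = a, column I 1 = b & column I 2 = c].
Proof.
move=> ab bc c6; have b6 := ltn_trans bc c6; have a6 := ltn_trans ab b6.
pose A : {set 'I_6} := [set inord a; inord b; inord c].
have enumA : [seq val i | i <- enum A] = [:: a; b; c].
  apply: (irr_sorted_eq ltn_trans ltnn) (sorted_enum_ord A) _ _.
    by rewrite /= ab bc.
  move=> k; rewrite !inE; apply/mapP/or3P.
    case=> i; rewrite mem_enum !inE -!val_eqE /= !inordK // => h ->.
    by apply/or3P; rewrite -orbA in h.
  by case=> /eqP ->; [exists (inord a) | exists (inord b) | exists (inord c)];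
    rewrite ?mem_enum ?inE ?eqxx ?orbT //= inordK.
have cA : #|A| == 3 by rewrite cardE -(size_map val) enumA.
exists (exist _ A cA); rewrite /column /=.
by move: enumA; case: (enum A) => [|? [|? [|? []]]] //= [<- <- <-].
Qed.

(** I = J is allowed: with y = 0 it yields a single minor. *)
Lemma spinor_form_sum2 e (I J : subset36) (x y : F) :
  spinor_form e [ffun K => (K == I)%:R * x + (K == J)%:R * y] =
  x *: minor_form F e (column I 0) (column I 1) (column I 2) +
  y *: minor_form F e (column J 0) (column J 1) (column J 2).
Proof.
have one (H : subset36) z : \sum_K ((K == H)%:R * z) *:
    minor_form F e (column K 0) (column K 1) (column K 2) =
    z *: minor_form F e (column H 0) (column H 1) (column H 2).
  rewrite (bigD1 H) //= big1 ?addr0 ?eqxx ?mul1r // => K /negPf ->.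
  by rewrite mul0r scale0r.
rewrite -!one -big_split; apply: eq_bigr => K _.
by rewrite ffunE scalerDl.
Qed.

(** Bounds the weights of the examples from above; the general counts give the matching lower
    bounds. *)
Lemma card_two_coords (S T : {set F}) :
  (#|[set s : 'rV[F]_4 | (s^[0] \in S) && (s^[1] \in T)]| <= #|S| * #|T| * #|F| ^ 2)%N.
Proof.
pose h s := ((s^[0], s^[1]), (s^[2], s^[3])).
rewrite -mulnn -!cardsT -!cardsX -(@card_imset _ _ h).
  apply/subset_leq_card/subsetP => x /imsetP[s]; rewrite inE => /andP[sS sT] ->.
  by rewrite !inE /= sS sT.
move=> s s' [h0 h1 h2 h3]; apply/rowP; elim/forall_ord4; assumption.
Qed.

Variables (n : nat) (L : n.-tuple 'M[F]_(3, 6)).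
Hypothesis hL : representatives L.

Lemma weight_one_family f w : (forall s, qf (spinor_form true f) s = 0) ->
  #|[set s | qf (spinor_form false f) s != 0%R]| = ((#|F| - 1) * w)%N ->
  hamming_weight (evL L f) = w.
Proof.
move=> f1 f0; have q1 := finNzRing_gt1 F.
have := weight_spinors hL f; rewrite big_bool f0 (card_qf_zero f1) /=.
by rewrite add0n => /eqP; rewrite eqn_pmul2l ?subn_gt0 // => /eqP.
Qed.

Lemma weight_square : 2%:R = 0 :> F ->
  exists f, hamming_weight (evL L f) = (#|F| ^ 3)%N.
Proof.
(* This minor is s_0^2 on the first family and 0 on the second, where it becomes the minor of
   columns 3, 4, 5. *)
move=> two0; have [I [I0 I1 I2]] := @exists_column 0 1 2 isT isT isT.
exists [ffun K => (K == I)%:R * 1 + (K == I)%:R * 0].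
apply: weight_one_family => [s|]; rewrite spinor_form_sum2 I0 I1 I2
  /minor_form /= !scale0r addr0 scale1r ?scaler0 /qf ?mulmx0 ?mul0mx ?mxE //.
rewrite !expr0 !scale1r; apply/eqP; rewrite eqn_leq; apply/andP; split.
  apply: leq_trans (subset_leq_card _) (leq_trans (card_two_coords [set~ 0] setT) _).
    apply/subsetP => s; rewrite !inE qform_delta andbT.
    by apply: contraNneq => ->; rewrite mul0r.
  by rewrite cardsC1 cardsT -subn1 -mulnA -expnS.
apply: card_qf4_neq0_polar.
  apply/matrixP => i j; rewrite !mxE andbC.
  by case: (_ && _); rewrite ?addr0 // -mulr2n two0.
by exists (delta_mx 0 (inord 0)); rewrite /qf qform_delta !mxE !eqxx mulr1 oner_eq0.
Qed.

Lemma weight_hyperbolic : 2%:R != 0 :> F ->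
  exists f, hamming_weight (evL L f) = (#|F| ^ 3 - #|F| ^ 2)%N.
Proof.
(* Both minors give -s_0 s_1 on the first family and opposite multiples of s_2 s_3 on the second, so
   their sum is the pair (-2 s_0 s_1, 0). *)
move=> two0; have [I [I0 I1 I2]] := @exists_column 0 1 4 isT isT isT.
have [J [J0 J1 J2]] := @exists_column 0 2 3 isT isT isT.
have q1 := finNzRing_gt1 F.
exists [ffun K => (K == I)%:R * 1 + (K == J)%:R * 1].
apply: weight_one_family => [s|]; rewrite spinor_form_sum2 I0 I1 I2 J0 J1 J2
  /minor_form /= !scale1r ?expr0 ?expr1 ?scale1r.
  by rewrite !scaleN1r opprK addrN /qf mulmx0 mul0mx mxE.
rewrite -mulr2n -scaler_nat scalerA; set c := _ * -1.
have c0 : c != 0 by rewrite /c mulrN1 oppr_eq0.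
have qfE s : qf (c *: delta_mx (inord 0) (inord 1)) s = c * (s^[0] * s^[1]).
  by rewrite /qf -scalemxAr -scalemxAl mxE qform_delta.
have -> : ((#|F| - 1) * (#|F| ^ 3 - #|F| ^ 2) = (#|F| - 1) ^ 2 * #|F| ^ 2)%N.
  by move: #|F| q1 => r r1; rewrite !expnS expn0; nia.
apply/eqP; rewrite eqn_leq; apply/andP; split.
  apply: leq_trans (subset_leq_card _) (leq_trans (card_two_coords [set~ 0] [set~ 0]) _).
    apply/subsetP => s; rewrite !inE qfE => h; apply/andP; split;
    by apply: contraNneq h => ->; rewrite ?mul0r !mulr0.
  by rewrite cardsC1 -subn1 mulnn.
apply: card_qf4_neq0; exists (const_mx 1).
by rewrite qfE !mxE !mulr1.
Qed.

End Examples.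

Theorem theorem7p11 (q : nat)
  (hq : exists p k : nat, [/\ prime p, (0 < k)%N & q = (p ^ k)%N])
  (F : finFieldType) (hF : #|F| = q)
  (n : nat) (L : n.-tuple 'M[F]_(3, 6)) (hL : representatives L) :
  is_min_distance (code36 L)
    (if odd q then (q ^ 3 - q ^ 2)%N else (q ^ 3)%N).
Proof.
have q1 : (1 < q)%N by rewrite -hF finNzRing_gt1.
have evLP f : evL L f \in code36 L by apply/imsetP; exists f.
have attained d f : (0 < d)%N -> hamming_weight (evL L f) = d ->
    exists c, [/\ c \in code36 L, c != 0 & hamming_weight c = d].
  move=> d0 fd; exists (evL L f); split=> //; apply: contraTneq d0 => f0.
  rewrite -fd f0 -leqNgt leqn0 cards_eq0; apply/eqP/setP => i.
  by rewrite !inE mxE eqxx.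
(* q is a power of the characteristic p, so q is even exactly when p = 2. *)
have oddE : odd q = (2%:R != 0 :> F).
  case: hq => p [k [pp k0 qE]]; have := card_finPcharP _ pp; move: hF; rewrite qE => Fpk.
  move/(_ _ _ Fpk) => chF; rewrite -(dvdn_pcharf chF) oddX.
  have [->|/negPf podd] := eqVneq p 2; first by rewrite (gtn_eqF k0).
  by rewrite dvdn_prime2 // eq_sym podd; case: (even_prime pp) podd => [->|->] //; rewrite orbT.
rewrite oddE; split.
  case: ifP => [|/negbFE/eqP] two0.
    have [f] := weight_hyperbolic hL two0; rewrite hF => /attained; apply.
    by rewrite subn_gt0 ltn_exp2l.
  have [f] := weight_square hL two0; rewrite hF => /attained; apply.
  by rewrite expn_gt0 (ltnW q1).
move=> _ /imsetP[f _ ->] f0; rewrite -hF; case: ifP => [_|/negbFE/eqP two0].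
  exact: weight_ge.
exact: weight_ge_even.
Qed.
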